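(* Let $X$ be a separable real Banach space and let $(\Omega,\beta,\mu)$ be a complete probability measure space. Let $T:\Omega\times X\to X$ be a continuous random mapping such that there are real-valued random variables $\alpha_1,\alpha_2,\alpha_3:\Omega\to[0,\infty)$ with $\alpha_1(\omega)+\alpha_2(\omega)+\alpha_3(\omega)<1$ for all $\omega\in\Omega$ and, for every $\omega\in\Omega$ and all $X$-valued random variables $x_1,x_2:\Omega\to X$, $$\|T(\omega,x_1(\omega))-T(\omega,x_2(\omega))\|\le \alpha_1(\omega)\|x_1(\omega)-x_2(\omega)\|+\alpha_2(\omega)\|x_1(\omega)-T(\omega,x_1(\omega))\|+\alpha_3(\omega)\|x_2(\omega)-T(\omega,x_2(\omega))\|.$$ Then $T$ has a random fixed point, and it is unique (any two random fixed points of $T$ coincide almost surely).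
   Context: An $X$-valued random variable is a map $x:\Omega\to X$ such that $x^{-1}(B)\in\beta$ for every Borel set $B\subseteq X$. A random mapping is a map $T:\Omega\times X\to X$ such that $\omega\mapsto T(\omega,x)$ is an $X$-valued random variable for every fixed $x\in X$. A random mapping $T$ is continuous if the set of $\omega\in\Omega$ for which $x\mapsto T(\omega,x)$ is continuous has $\mu$-measure one. A random fixed point of $T$ is an $X$-valued random variable $x$ with $\mu\{\omega\in\Omega: T(\omega,x(\omega))=x(\omega)\}=1$. *)

(* Defs.v *)
From HB Require Import structures.
From mathcomp Require Import all_boot all_order all_algebra.
From mathcomp Require Import all_classical all_reals all_analysis.
Set Implicit Arguments. Unset Strict Implicit. Unset Printing Implicit Defensive.
Import Order.TTheory GRing.Theory Num.Theory.
Import numFieldNormedType.Exports.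
Local Open Scope classical_set_scope.
Local Open Scope ring_scope.

Definition borel_sets (X : topologicalType) : set (set X) :=
  <<s setT, @open X >>.

Definition separable_space (X : topologicalType) : Prop :=
  exists D : set X, countable D /\ dense D.

Definition complete_measure d (T : measurableType d) (R : realType)
  (mu : set T -> \bar R) : Prop :=
  forall N : set T, measurable N -> mu N = 0%E ->
    forall A : set T, A `<=` N -> measurable A.

Definition X_random_variable d (T : measurableType d) (X : topologicalType)
  (x : T -> X) : Prop :=
  forall B : set X, borel_sets B -> measurable (x @^-1` B).

Definition full_measure d (T : measurableType d) (R : realType)
  (mu : set T -> \bar R) (S : set T) : Prop :=
  measurable S /\ mu S = 1%E.

Definition random_mapping d (T : measurableType d) (X : topologicalType)
  (F : T -> X -> X) : Prop :=
  forall x : X, X_random_variable (fun w => F w x).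

Definition continuous_random_mapping d (T : measurableType d) (R : realType)
  (mu : set T -> \bar R) (X : topologicalType) (F : T -> X -> X) : Prop :=
  random_mapping F /\ full_measure mu [set w | continuous (F w)].

Definition random_fixed_point d (T : measurableType d) (R : realType)
  (mu : set T -> \bar R) (X : topologicalType) (F : T -> X -> X)
  (x : T -> X) : Prop :=
  X_random_variable x /\ full_measure mu [set w | F w (x w) = x w].

(* Main.v *)
(* For each [w], [F w] is a Reich map: its Picard iterates have increments
   shrinking by the factor [(a1 + a3) / (1 - a2) < 1], hence converge to a fixed
   point, which is unique.  The fixed point [z] is measurable in [w] without any
   selection theorem: [|u - z|] and the residual [|u - F w u|] bound each other
   up to constants, so whether [z] lies in a ball is decided by countably many
   inequalities between residuals at a dense sequence, each measurable in [w].
   Two random fixed points agree on the intersection of two full-measure sets,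
   and completeness makes the superset [[set w | x w = y w]] measurable. *)

Require Import Defs.
From HB Require Import structures.
From mathcomp Require Import all_boot all_order all_algebra.
From mathcomp Require Import all_classical all_reals all_analysis.
From mathcomp Require Import lra measurable_realfun.
Import Order.TTheory GRing.Theory Num.Theory.
Import numFieldNormedType.Exports.
Local Open Scope classical_set_scope.
Local Open Scope ring_scope.

Lemma cvgn_ratio_increments {R : realType} {X : completeNormedModType R}
    (y : nat -> X) (k : R) : 0 <= k < 1 ->
  (forall n, `|y n.+2 - y n.+1| <= k * `|y n.+1 - y n|) -> cvgn y.
Proof.
move=> /andP[k_ge0 k_lt1] yk.
have y_geo n : `|telescope y n| <= geometric `|y 1 - y 0| k n.
  rewrite /= mulrC; elim: n => [|n IHn]; first by rewrite expr0 mul1r.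
  by rewrite (le_trans (yk n))// exprS -mulrA ler_wpM2l.
have : cvgn (series (telescope y)).
  apply: normed_cvg; apply: (series_le_cvg _ _ y_geo) => // [n|].
    by rewrite /= mulr_ge0// exprn_ge0.
  by apply: is_cvg_geometric_series; rewrite ger0_norm.
move=> /(is_cvgD (is_cvg_cst (y 0%N))).
rewrite [X in cvgn X -> _](_ : _ = y)//.
by apply/funext => n; rewrite [RHS]eq_sum_telescope.
Qed.

Section reich_map.
Context {R : realType} {X : normedModType R} {G : X -> X} {b1 b2 b3 : R}.
Hypotheses (b1_ge0 : 0 <= b1) (b2_ge0 : 0 <= b2) (b3_ge0 : 0 <= b3).
Hypothesis b_lt1 : b1 + b2 + b3 < 1.
Hypothesis reichG : forall u v,
  `|G u - G v| <= b1 * `|u - v| + b2 * `|u - G u| + b3 * `|v - G v|.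

(* [lra] and [nra] ignore section hypotheses, so they are passed explicitly. *)
Local Ltac reich_nra := move: b1_ge0 b2_ge0 b3_ge0 b_lt1; nra.

Lemma reich_fixed_point_unique u v : G u = u -> G v = v -> u = v.
Proof.
move=> Gu Gv; have := reichG u v; rewrite Gu Gv !subrr normr0 !mulr0 !addr0.
have := normr_ge0 (u - v) => uv_ge0 uv_le.
by apply/subr0_eq/normr0_eq0/le_anti; rewrite uv_ge0 andbT; reich_nra.
Qed.

Lemma reich_dist_fixed_le z : G z = z ->
  forall u, (1 - b1) * `|u - z| <= (1 + b2) * `|u - G u|.
Proof.
move=> Gz u; have := reichG u z; rewrite Gz subrr normr0 mulr0 addr0.
have := ler_distD (G u) u z; rewrite (distrC u (G u)).
have := normr_ge0 (u - z); have := normr_ge0 (G u - u); reich_nra.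
Qed.

Lemma reich_residual_le z : G z = z ->
  forall u, (1 - b3) * `|u - G u| <= (1 + b1) * `|u - z|.
Proof.
move=> Gz u; have := reichG z u; rewrite Gz subrr normr0 mulr0 addr0 (distrC z u).
have := ler_distD z u (G u); rewrite (distrC u z).
have := normr_ge0 (u - z); have := normr_ge0 (u - G u); reich_nra.
Qed.

Lemma reich_step u :
  `|G (G u) - G u| <= (b1 + b3) / (1 - b2) * `|G u - u|.
Proof.
have b2_lt1 : 0 < 1 - b2 by reich_nra.
rewrite mulrAC ler_pdivlMr//.
have := reichG (G u) u; rewrite (distrC (G u) (G (G u))) (distrC u (G u)).
have := normr_ge0 (G (G u) - G u); have := normr_ge0 (G u - u); reich_nra.
Qed.

Lemma reich_limit_fixed (y : nat -> X) z :
  (forall n, y n.+1 = G (y n)) -> y @ \oo --> z -> G z = z.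
Proof.
move=> yS yz; apply/subr0_eq/normr0_eq0/le_anti; rewrite normr_ge0 andbT distrC.
have b3_lt1 : 0 < 1 - b3 by reich_nra.
rewrite -(pmulr_rle0 _ b3_lt1); apply/ler_addgt0Pr => e e_gt0; rewrite add0r.
(* [|z - G z| <= |z - y N.+1| + |G (y N) - G z|], and the Reich bound on the
   last term contributes only [b3 |z - G z|] besides vanishing terms. *)
have [N _ yN] : \forall n \near \oo, `|z - y n| <= e / 4.
  exact: cvgr_dist_le _ _ yz _ (divr_gt0 e_gt0 (ltr0n _ 4)).
have yN_z : `|y N - z| <= e / 4 by rewrite distrC; exact: yN N (leqnn N).
have yN1_z : `|z - y N.+1| <= e / 4 by exact: yN N.+1 (leqnSn N).
have yN_yN1 : `|y N - y N.+1| <= e / 2.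
  by rewrite (le_trans (ler_distD z _ _))//; lra.
have b1_yN_z : b1 * `|y N - z| <= e / 4.
  by rewrite -[e / 4]mul1r ler_pM//; reich_nra.
have b2_yN_yN1 : b2 * `|y N - y N.+1| <= e / 2.
  by rewrite -[e / 2]mul1r ler_pM//; reich_nra.
have := reichG (y N) z; rewrite -yS.
have := ler_distD (y N.+1) z (G z); lra.
Qed.

End reich_map.

Lemma reich_fixed_point_exists {R : realType} {X : completeNormedModType R}
    {G : X -> X} {b1 b2 b3 : R} :
  0 <= b1 -> 0 <= b2 -> 0 <= b3 -> b1 + b2 + b3 < 1 ->
  (forall u v,
    `|G u - G v| <= b1 * `|u - v| + b2 * `|u - G u| + b3 * `|v - G v|) ->
  exists z, G z = z.
Proof.
move=> b1_ge0 b2_ge0 b3_ge0 b_lt1 reichG.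
pose y n := iter n G 0.
have k_ge0_lt1 : 0 <= (b1 + b3) / (1 - b2) < 1.
  have b2_lt1 : 0 < 1 - b2 by lra.
  by rewrite divr_ge0 ?ltr_pdivrMr ?mul1r//=; lra.
have /cvg_ex[z yz] : cvgn y.
  apply: (@cvgn_ratio_increments _ _ y _ k_ge0_lt1) => n.
  exact: reich_step b1_ge0 b2_ge0 b3_ge0 b_lt1 reichG (y n).
exists z.
exact: reich_limit_fixed b1_ge0 b2_ge0 b3_ge0 b_lt1 reichG y z (fun=> erefl) yz.
Qed.

Definition dense_seq {R : numDomainType} {X : normedModType R} (dd : nat -> X) :=
  forall (p : X) (eps : R), 0 < eps -> exists j, `|p - dd j| < eps.

Lemma separable_dense_seq {R : realType} {X : normedModType R} :
  separable_space X -> exists dd : nat -> X, dense_seq dd.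
Proof.
move=> [D [D_cnt D_dense]].
have [dd dd_surj] : exists dd : nat -> X, set_surj setT D dd by apply/pcard_surjP.
exists dd => p eps eps_gt0.
have [q [pq Dq]] :=
  D_dense (ball p eps) (ex_intro _ p (ballxx p eps_gt0)) (ball_open p eps).
have [j _ jq] := dd_surj _ Dq.
by exists j; move: pq; rewrite jq -ball_normE.
Qed.

Lemma dist_lt_dense_boundP {R : realType} {X : normedModType R}
    {dd : nat -> X} {phi : X -> R} {z : X} (e : X) {c c2 c3 C : R} (r : R) :
  dense_seq dd -> 0 < c -> 0 <= c2 -> 0 < c3 -> 0 <= C ->
  (forall u, c * `|u - z| <= c2 * phi u) -> (forall u, c3 * phi u <= C * `|u - z|) ->
  `|e - z| < r <-> exists j, c * (`|dd j - e| - r) + c2 * phi (dd j) < 0.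
Proof.
move=> dd_dense c_gt0 c2_ge0 c3_gt0 C_ge0 phi_ge phi_le; split=> [ez_lt|[j]].
  pose s := r - `|e - z|; pose k := c3 * c + c2 * C.
  have s_gt0 : 0 < s by rewrite subr_gt0.
  have k_gt0 : 0 < k by rewrite /k ltr_wpDr ?mulr_ge0 ?mulr_gt0.
  have [j zj] := dd_dense z (c3 * c * s / k)
    (divr_gt0 (mulr_gt0 (mulr_gt0 c3_gt0 c_gt0) s_gt0) k_gt0).
  exists j; rewrite -(pmulr_rlt0 _ c3_gt0).
  move: zj; rewrite distrC ltr_pdivlMr // => zj.
  have ej_le : c3 * c * (`|dd j - e| - r) <= c3 * c * (`|dd j - z| - s).
    rewrite ler_pM2l ?mulr_gt0//.
    have := ler_distD z (dd j) e; rewrite (distrC z e) /s; lra.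
  have phij_le : c2 * (c3 * phi (dd j)) <= c2 * (C * `|dd j - z|).
    exact: ler_wpM2l (phi_le _).
  rewrite /k in zj; lra.
have := phi_ge (dd j); have := ler_distD (dd j) e z; rewrite (distrC e (dd j)).
have := normr_ge0 (dd j - z); nra.
Qed.

Section X_random_variable.
Context {d : measure_display} {Omega : measurableType d}.

Lemma X_random_variable_cst {X : topologicalType} (u : X) :
  X_random_variable (fun _ : Omega => u).
Proof.
move=> B _; rewrite preimage_cst.
by case: ifP => _; [exact: measurableT | exact: measurable0].
Qed.

Lemma X_random_variable_open {X : topologicalType} (x : Omega -> X) :
  (forall U, open U -> measurable (x @^-1` U)) -> X_random_variable x.
Proof.
move=> x_open B; apply: (@smallest_sub _ _ _ [set B | measurable (x @^-1` B)]) => //.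
split=> [|A mA|A mA] /=.
- by rewrite preimage_set0.
- by rewrite setTD -preimage_setC; exact: measurableC.
- by rewrite preimage_bigcup; exact: bigcupT_measurable.
Qed.

Context {R : realType} {X : normedModType R}.

Lemma X_random_variable_ball {dd : nat -> X} (x : Omega -> X) : dense_seq dd ->
  (forall e r, measurable (x @^-1` ball e r)) -> X_random_variable x.
Proof.
move=> dd_dense x_ball; apply: X_random_variable_open => U U_open.
rewrite (_ : x @^-1` U = \bigcup_j
    \bigcup_(n in [set n | ball (dd j) n.+1%:R^-1 `<=` U])
      x @^-1` ball (dd j) n.+1%:R^-1).
  by apply: bigcupT_measurable => j; exact: bigcup_measurable.
apply/seteqP; split=> [w Uxw|w [j _ [n /= bU]]]; last exact: bU.
have [r r_gt0 rU] : exists2 r : R, 0 < r & ball (x w) r `<=` U.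
  by apply/nbhs_ballP; apply: open_nbhs_nbhs.
have r2_gt0 : 0 < r / 2 by rewrite divr_gt0.
have [N _ NS] := near_infty_natSinv_lt (PosNum r2_gt0).
have N_lt := NS N (leqnn N); rewrite /= in N_lt.
have [j xj] : exists j, `|x w - dd j| < N.+1%:R^-1.
  by apply: dd_dense; rewrite invr_gt0.
exists j => //; exists N; last by rewrite /= /preimage /= -ball_normE /= distrC.
move=> t; rewrite -ball_normE /= => jt; apply: rU; rewrite -ball_normE /=.
rewrite (le_lt_trans (ler_distD (dd j) _ _))// [r]splitr.
by rewrite ltrD// (lt_trans _ N_lt).
Qed.

Lemma measurable_fun_dist (x : Omega -> X) (u : X) :
  X_random_variable x -> measurable_fun setT (fun w => `|u - x w|).
Proof.
move=> x_rv; apply: (measurability _ (RGenInftyO.measurableE R)) => //.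
move=> _ [_ [r ->] <-]; rewrite setTI.
rewrite (_ : _ @^-1` _ = x @^-1` ball u r).
  by apply: x_rv; apply: sub_sigma_algebra; exact: ball_open.
by apply/seteqP; split=> w /=; rewrite -ball_normE /= in_itv.
Qed.

End X_random_variable.

Section full_measure.
Context {d : measure_display} {Omega : measurableType d} {R : realType}
  {P : probability Omega R}.

Lemma full_measureCP {A : set Omega} : measurable A ->
  full_measure P A <-> P (~` A) = 0%E.
Proof.
move=> mA; split=> [[_ PA]|PCA]; first by rewrite probability_setC// PA subee.
by split=> //; rewrite -[A]setCK probability_setC ?PCA ?sube0//; exact: measurableC.
Qed.

Lemma full_measureT : full_measure P setT.
Proof. by split; [exact: measurableT | exact: probability_setT]. Qed.

Lemma full_measureI {A B : set Omega} :
  full_measure P A -> full_measure P B -> full_measure P (A `&` B).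
Proof.
move=> fA fB; have [[mA _] [mB _]] := (fA, fB); have mAB := measurableI _ _ mA mB.
apply/(full_measureCP mAB)/le_anti; rewrite measure_ge0 andbT setCI.
rewrite (le_trans (measureU2 _ (measurableC mA) (measurableC mB)))//.
rewrite -[leLHS]/(P (~` A) + P (~` B))%E.
by rewrite ((full_measureCP mA).1 fA) ((full_measureCP mB).1 fB) adde0.
Qed.

Lemma full_measure_sub {A B : set Omega} : complete_measure P ->
  full_measure P A -> A `<=` B -> full_measure P B.
Proof.
move=> P_complete fA AB; have [mA _] := fA; have PCA := (full_measureCP mA).1 fA.
have mCB : measurable (~` B) := P_complete _ (measurableC mA) PCA _ (subsetC AB).
have mB : measurable B by rewrite -[B]setCK; exact: measurableC.
apply/(full_measureCP mB)/le_anti; rewrite measure_ge0 andbT -PCA.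
by apply: le_measure; rewrite ?inE//; [exact: measurableC | exact: subsetC].
Qed.

End full_measure.

Lemma X_random_variable_reich_fixed_point {R : realType} {X : normedModType R}
    {d : measure_display} {Omega : measurableType d}
    (F : Omega -> X -> X) (a1 a2 a3 : Omega -> R) (x : Omega -> X) :
  separable_space X -> random_mapping F ->
  measurable_fun setT a1 -> measurable_fun setT a2 ->
  (forall w, 0 <= a1 w) -> (forall w, 0 <= a2 w) -> (forall w, 0 <= a3 w) ->
  (forall w, a1 w + a2 w + a3 w < 1) ->
  (forall w u v, `|F w u - F w v| <=
     a1 w * `|u - v| + a2 w * `|u - F w u| + a3 w * `|v - F w v|) ->
  (forall w, F w (x w) = x w) -> X_random_variable x.
Proof.
move=> X_sep F_rm a1_mf a2_mf a1_ge0 a2_ge0 a3_ge0 a_lt1 reichF x_fix.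
have [dd dd_dense] := separable_dense_seq X_sep.
apply: (X_random_variable_ball _ dd_dense) => e r.
pose g j w := (1 - a1 w) * (`|dd j - e| - r) + (1 + a2 w) * `|dd j - F w (dd j)|.
have x_ball w : `|e - x w| < r <-> exists j, g j w < 0.
  move: (a1_ge0 w) (a2_ge0 w) (a3_ge0 w) (a_lt1 w) => a1w_ge0 a2w_ge0 a3w_ge0 aw_lt1.
  apply: (dist_lt_dense_boundP (phi := fun u => `|u - F w u|)
    (c3 := 1 - a3 w) (C := 1 + a1 w) e r dd_dense); [lra | lra | lra | lra | |].
  - exact: reich_dist_fixed_le a1w_ge0 a2w_ge0 a3w_ge0 aw_lt1 (reichF w) _ (x_fix w).
  - exact: reich_residual_le a1w_ge0 a2w_ge0 a3w_ge0 aw_lt1 (reichF w) _ (x_fix w).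
rewrite (_ : x @^-1` ball e r = \bigcup_j [set w | g j w < 0]).
  apply: bigcupT_measurable => j.
  have g_mf : measurable_fun setT (g j).
    apply: measurable_funD; apply: measurable_funM => //.
    - by apply: measurable_funB => //; exact: measurable_cst.
    - by apply: measurable_funD => //; exact: measurable_cst.
    - exact: measurable_fun_dist.
  have := g_mf measurableT _ (measurable_itv `]-oo, 0[); rewrite setTI.
  by congr measurable; apply/seteqP; split=> w /=; rewrite in_itv.
apply/seteqP; split=> w; rewrite /preimage /= -ball_normE /= x_ball.
  by move=> [j]; exists j.
by move=> [j _]; exists j.
Qed.

Theorem corollary3p3 (R : realType) (X : completeNormedModType R)
  (d : measure_display) (Omega : measurableType d) (P : probability Omega R)
  (F : Omega -> X -> X) (a1 a2 a3 : Omega -> R) :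
  separable_space X ->
  complete_measure P ->
  continuous_random_mapping P F ->
  measurable_fun setT a1 -> measurable_fun setT a2 -> measurable_fun setT a3 ->
  (forall w, 0 <= a1 w) -> (forall w, 0 <= a2 w) -> (forall w, 0 <= a3 w) ->
  (forall w, a1 w + a2 w + a3 w < 1) ->
  (forall (w : Omega) (x1 x2 : Omega -> X),
      X_random_variable x1 -> X_random_variable x2 ->
      `|F w (x1 w) - F w (x2 w)| <=
        a1 w * `|x1 w - x2 w| + a2 w * `|x1 w - F w (x1 w)|
        + a3 w * `|x2 w - F w (x2 w)|) ->
  (exists x : Omega -> X, random_fixed_point P F x) /\
  (forall x y : Omega -> X, random_fixed_point P F x -> random_fixed_point P F y ->
     full_measure P [set w | x w = y w]).
Proof.
move=> X_sep P_complete [F_rm _] a1_mf a2_mf _ a1_ge0 a2_ge0 a3_ge0 a_lt1 reichF_rv.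
have reichF w u v : `|F w u - F w v| <=
    a1 w * `|u - v| + a2 w * `|u - F w u| + a3 w * `|v - F w v|.
  exact: reichF_rv w _ _ (X_random_variable_cst u) (X_random_variable_cst v).
have [x x_fix] := choice (fun w =>
  reich_fixed_point_exists (a1_ge0 w) (a2_ge0 w) (a3_ge0 w) (a_lt1 w) (reichF w)).
split.
  exists x; split.
    exact: X_random_variable_reich_fixed_point
      X_sep F_rm a1_mf a2_mf a1_ge0 a2_ge0 a3_ge0 a_lt1 reichF x_fix.
  exact: full_measure_sub P_complete full_measureT (fun w _ => x_fix w).
move=> y z [_ y_fix] [_ z_fix].
apply: full_measure_sub P_complete (full_measureI y_fix z_fix) _ => w [yw zw].
exact: reich_fixed_point_unique
  (a1_ge0 w) (a2_ge0 w) (a3_ge0 w) (a_lt1 w) (reichF w) _ _ yw zw.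
Qed.
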